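(* Let $d\ge 3$ be an integer. There exist a closed uncountable set $E\subset\mathbb{R}$ and a constant $\varepsilon_0>0$ such that for every function $\varepsilon\colon\mathbb{N}\to(0,\infty)$ with $\varepsilon(n)\le\varepsilon_0$ for all $n$ and every $\alpha\in E$, the set $$\{n\in\mathbb{N} : \|\alpha n^d\|_{\mathbb{R}/\mathbb{Z}}\le\varepsilon(n)\}$$ is not a basis of order $2$.
   Context: $\mathbb{N}=\{0,1,2,\dots\}$ and $\|t\|_{\mathbb{R}/\mathbb{Z}}=\min_{n\in\mathbb{Z}}|t-n|$. A set $\mathcal{A}\subset\mathbb{N}$ is a basis of order $2$ if $2\mathcal{A}=\{n_1+n_2 : n_1,n_2\in\mathcal{A}\}$ contains all sufficiently large integers. *)

(* Defs.v *)
From HB Require Import structures.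
From mathcomp Require Import all_boot all_order all_algebra.
From mathcomp Require Import all_classical all_reals all_analysis.
Set Implicit Arguments.
Unset Strict Implicit.
Unset Printing Implicit Defensive.
Import Order.TTheory GRing.Theory Num.Theory.
Import numFieldNormedType.Exports.
Local Open Scope classical_set_scope.
Local Open Scope ring_scope.

(* The infimum is attained (distZ_attained), so this is the minimum of
   |t - n| over the integers n. *)
Definition distZ (R : realType) (t : R) : R :=
  inf [set `|t - n%:~R| | n in [set: int]].

Definition sumset (A B : set nat) : set nat :=
  [set (a + b)%N | a in A & b in B].

Definition basis_of_order2 (A : set nat) : Prop :=
  \forall n \near \oo, sumset A A n.

Lemma distZ_lb (R : realType) (t : R) (n : int) : distZ t <= `|t - n%:~R|.
Proof.
by apply: ge_inf; [exists 0 => _ [m _ <-]; exact: normr_ge0 | exists n].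
Qed.

Lemma distZ_attained (R : realType) (t : R) :
  exists n : int, distZ t = `|t - n%:~R|.
Proof.
have fl := floor_le t; have fu := floorD1_gt t.
set m := Num.floor t in fl fu *.
have key (k : int) : (k <= m)%R || (m + 1 <= k)%R.
  by rewrite lezD1; case: leP.
have E (n : int) : (forall k : int, `|t - n%:~R| <= `|t - k%:~R|) ->
    distZ t = `|t - n%:~R|.
  move=> H; apply/eqP; rewrite eq_le distZ_lb /=.
  apply: lb_le_inf; first by exists `|t - n%:~R|; exists n.
  by move=> _ [k _ <-].
have L (k : int) : k <= m -> `|t - m%:~R| <= `|t - k%:~R|.
  move=> km; have km' : (k%:~R : R) <= m%:~R by rewrite ler_int.
  rewrite !ger0_norm ?subr_ge0 ?(le_trans km') //.
  by rewrite lerD2l lerN2.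
have U (k : int) : m + 1 <= k -> `|t - (m + 1)%:~R| <= `|t - k%:~R|.
  move=> mk; have mk' : ((m + 1)%:~R : R) <= k%:~R by rewrite ler_int.
  rewrite !ler0_norm ?subr_le0 ?(ltW fu) ?(le_trans (ltW fu)) //.
  by rewrite lerN2 lerD2l lerN2.
have [h|h] := leP `|t - m%:~R| `|t - (m + 1)%:~R|.
  exists m; apply: E => k; case/orP: (key k) => [/L //|/U]; exact: le_trans.
exists (m + 1); apply: E => k; case/orP: (key k) => [/L|/U //].
by apply: le_trans; exact: ltW.
Qed.

(* Main.v *)
Require Import Defs.
From HB Require Import structures.
From mathcomp Require Import all_boot all_order all_algebra.
From mathcomp Require Import all_classical all_reals all_analysis.
From mathcomp Require Import ring lra zify.
Set Implicit Arguments.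
Unset Strict Implicit.
Unset Printing Implicit Defensive.
Import Order.TTheory GRing.Theory Num.Theory.
Import numFieldNormedType.Exports.
Local Open Scope classical_set_scope.
Local Open Scope ring_scope.

(** Let [N] be odd and suppose that [alpha] lies within [1 / (8 N ^ d)] of a
    fraction [a / (2 N)] with [a] odd. If [m + n = N], then
    [m ^ d - (- n) ^ d = N Q] with [Q] odd, so [alpha (m ^ d - (- n) ^ d)] is
    within [1/8] of a half-integer, and [alpha m ^ d], [alpha n ^ d] cannot both
    be within [1/8] of integers. Hence no [alpha] with infinitely many such [N]
    gives a basis. With [N_0 = 3] and [N_(j+1) = 27 N_j ^ d], the numbers
    [1/2 + \sum_j s_j / N_j], where [s_j] is 0 or 1, are approximated in this way
    for every [N_j]; Cantor's diagonal argument shows that they are uncountably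
    many. *)

Lemma distZ_lipschitz (R : realType) (s t : R) : distZ s <= distZ t + `|s - t|.
Proof.
have [n ->] := distZ_attained t.
apply: le_trans (distZ_lb s n) _.
have -> : s - n%:~R = (t - n%:~R) + (s - t) by ring.
exact: ler_normD.
Qed.

Lemma continuous_distZ (R : realType) : continuous (@distZ R).
Proof.
move=> t; apply/cvgrPdist_le => e e0.
near=> s.
have st : `|t - s| <= e by near: s; exact: cvgr_dist_le.
rewrite ler_norml; have := distZ_lipschitz s t; have := distZ_lipschitz t s.
by rewrite (distrC s t) => h1 h2; apply/andP; split; lra.
Unshelve. all: by end_near.
Qed.

Lemma expf_F2 (x : 'F_2) (d : nat) : (0 < d)%N -> x ^+ d = x.
Proof.
case: d => // d _; have [->|->] : x = 0 \/ x = 1.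
  by case: x => -[|[|//]] ?; [left|right]; apply: val_inj.
- by rewrite expr0n.
- by rewrite expr1n.
Qed.

(* The residue of [Q] mod 2 is expressed in ['F_2], where [x ^+ d = x]. *)
Lemma odd_quotient_pow (m n d : nat) : (0 < d)%N -> odd (m + n) ->
  exists Q : int, m%:Z ^+ d - (- n%:Z) ^+ d = (m + n)%N%:Z * Q /\
    Q%:~R = 1 :> 'F_2.
Proof.
move=> d0 omn; set Q := \sum_(i < d) m%:Z ^+ (d.-1 - i) * (- n%:Z) ^+ i.
have E : m%:Z ^+ d - (- n%:Z) ^+ d = (m + n)%N%:Z * Q.
  by rewrite subrXX opprK PoszD.
exists Q; split=> //.
have mn1 : (m + n)%:R = 1 :> 'F_2.
  by rewrite -(odd_double_half (m + n)) omn natrD -mul2n natrM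
    pchar_Zp // mul0r addr0.
have := congr1 (fun z : int => z%:~R : 'F_2) E.
rewrite intrM -!pmulrn mn1 mul1r => <-.
by rewrite rmorphB /= !rmorphXn /= rmorphN /= !expf_F2 // opprK -!pmulrn -natrD.
Qed.

Lemma pow_add_le (m n d : nat) : (0 < d)%N -> (m ^ d + n ^ d <= (m + n) ^ d)%N.
Proof.
have le a b k : (a <= b)%N -> (a ^ k <= b ^ k)%N.
  by case: k => // k; rewrite leq_exp2r.
case: d => // d _; rewrite !expnSr mulnDr.
by apply: leq_add; rewrite leq_mul // le // (leq_addr, leq_addl).
Qed.

(** With [N = m + n] this bounds [N * Q] by [N ^ d], so an error in [alpha * N] of at most
    [N / (8 N ^ d)] stays below 1/8 when multiplied by [Q]. *)
Lemma quotient_pow_le (R : realDomainType) (m n d : nat) :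
  (0 < d)%N -> `|m%:R ^+ d - (- n%:R) ^+ d| <= (m + n)%:R ^+ d :> R.
Proof.
move=> d0; apply: le_trans (ler_normB _ _) _.
rewrite !normrX normrN !normr_nat -!natrX -natrD ler_nat.
exact: pow_add_le.
Qed.

Lemma odd_approx_obstruction (R : realType) (d m n : nat) (alpha : R) :
    (0 < d)%N -> odd (m + n) ->
    (m + n)%:R ^+ d * distZ (alpha * (m + n)%:R - 2^-1) <= (m + n)%:R / 8 ->
    distZ (alpha * m%:R ^+ d) <= 8^-1 -> distZ (alpha * n%:R ^+ d) <= 8^-1 ->
  False.
Proof.
move=> d0 omn.
have [Q [EQ Q1]] := odd_quotient_pow d0 omn.
have EQR : m%:R ^+ d - (- n%:R) ^+ d = (m + n)%:R * Q%:~R :> R.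
  have := congr1 (fun z : int => z%:~R : R) EQ.
  by rewrite intrM rmorphB /= !rmorphXn /= rmorphN /= -!pmulrn.
have := quotient_pow_le R m n d0; rewrite EQR.
set N : R := (m + n)%:R.
have N0 : 0 < N by rewrite ltr0n; case: (m + n)%N omn.
have [w ->] := distZ_attained (alpha * N - 2^-1).
have [u ->] := distZ_attained (alpha * m%:R ^+ d).
have [v ->] := distZ_attained (alpha * n%:R ^+ d).
set e := alpha * N - _ - _; rewrite normrM (gtr0_norm N0) => NQ eN um vn.
have eQ : `|e * Q%:~R| <= 8^-1.
  rewrite normrM -(ler_pM2l N0) mulrCA mulrC mulrAC.
  apply: le_trans eN.
  by rewrite -mulrA mulrC -mulrA [leLHS]mulrC ler_wpM2r // mulrC.
(* The integer near [alpha * (N * Q)], combined from [u] and [v] just as [N * Q] is from the two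
   powers. *)
pose s : int := u - (-1) ^+ d * v.
have close : `|alpha * (N * Q%:~R) - s%:~R| <= 4^-1.
  have -> : alpha * (N * Q%:~R) - s%:~R =
      (alpha * m%:R ^+ d - u%:~R) - (-1) ^+ d * (alpha * n%:R ^+ d - v%:~R).
    rewrite -EQR exprNn /s rmorphB /= intrM rmorphXn /= rmorphN1; ring.
  apply: le_trans (ler_normB _ _) _.
  rewrite normrM normrX normrN1 expr1n mul1r; lra.
(* Since [alpha * N = w + 1/2 + e], doubling leaves an integer of size at most 3/4, hence 0; yet it
   is odd, as [Q] is. *)
have ident : 2 * (alpha * (N * Q%:~R) - s%:~R) - 2 * (e * Q%:~R) =
    ((2 * w + 1) * Q - 2 * s)%:~R.
  rewrite !(intrB, intrD, intrM) /e; by field.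
have : `|((2 * w + 1) * Q - 2 * s)%:~R| < 1 :> R.
  rewrite -ident; apply: le_lt_trans (ler_normB _ _) _.
  rewrite !(normrM 2) (ger0_norm (ler0n _ 2)); lra.
rewrite -intr_norm ltrz1 -[1]add0r ltzD1 normr_le0 => /eqP z0.
have := congr1 (fun z : int => z%:~R : 'F_2) z0.
have two0 : (2 : int)%:~R = 0 :> 'F_2 by apply: val_inj.
by rewrite intrB !intrM (intrD _ (2 * w)) intrM two0 Q1 !mul0r add0r subr0
  => /eqP.
Qed.

(** The factor 27 is odd, which preserves oddness, and large enough that 2/27 < 1/8 in the error
    bound. *)
Fixpoint denom (d j : nat) : nat :=
  if j is j'.+1 then (27 * denom d j' ^ d)%N else 3.

Lemma denom_gt0 (d j : nat) : (0 < denom d j)%N.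
Proof. by elim: j => //= j IH; rewrite muln_gt0 expn_gt0 IH. Qed.

Lemma odd_denom (d j : nat) : odd (denom d j).
Proof. by elim: j => //= j IH; rewrite oddM oddX IH orbT. Qed.

Lemma denomS_ge (d j : nat) : (0 < d)%N -> (27 * denom d j <= denom d j.+1)%N.
Proof.
move=> d0; rewrite /= leq_mul2l /= -[X in (X <= _)%N]expn1.
by rewrite leq_pexp2l // denom_gt0.
Qed.

Lemma ltn_denom (d j : nat) : (0 < d)%N -> (j < denom d j)%N.
Proof.
move=> d0; elim: j => // j IH.
apply: leq_trans (denomS_ge j d0).
by have := denom_gt0 d j; lia.
Qed.

(* Divided by [N ^ d.+1], where [N = denom d j], the condition says that
   [alpha] is within [1 / (8 N ^ d)] of [a / (2 N)] for some odd [a]. *)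
Definition odd_approx_set (R : realType) (d : nat) : set R :=
  \bigcap_j [set alpha | (denom d j)%:R ^+ d *
    distZ (alpha * (denom d j)%:R - 2^-1) <= (denom d j)%:R / 8].

Lemma closed_odd_approx_set (R : realType) (d : nat) :
  closed (@odd_approx_set R d).
Proof.
apply: closed_bigI => j _.
set f : R -> R := fun alpha => (denom d j)%:R ^+ d *
  distZ (alpha * (denom d j)%:R - 2^-1).
apply: (@preimage_closed _ _ f [set x | x <= (denom d j)%:R / 8]);
  last exact: closed_le.
move=> x _; have ch :
    {for x, continuous (fun a : R => a * (denom d j)%:R - 2^-1)}.
  apply: cvgB; last exact: cvg_cst.
  by apply: cvgM; [exact: cvg_id | exact: cvg_cst].
apply: (@cvgM _ _ _ _ (cst _) (@distZ R \o _)); first exact: cvg_cst.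
exact: continuous_comp ch (@continuous_distZ R _).
Qed.

(* The digit chosen at each step keeps the limit away from [g j]. *)
Fixpoint diagonal (R : realType) (d : nat) (g : nat -> R) (j : nat) : R :=
  if j is j'.+1 then
    diagonal d g j' +
      (g j' < diagonal d g j' + (denom d j')%:R^-1)%R%:R / (denom d j')%:R
  else 2^-1.

(** All earlier denominators divide [denom d j], so the digits contribute integers; the initial 1/2
    times an odd number is a half-integer. *)
Lemma diagonal_half_int (R : realType) (d : nat) (g : nat -> R) (j : nat) :
  (0 < d)%N ->
  exists z : int, diagonal d g j.+1 * (denom d j)%:R - 2^-1 = z%:~R.
Proof.
move=> d0.
have step i (z : int) : diagonal d g i * (denom d i)%:R - 2^-1 = z%:~R ->
    exists z : int, diagonal d g i.+1 * (denom d i)%:R - 2^-1 = z%:~R.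
  move=> E; exists (z + (g i < diagonal d g i + (denom d i)%:R^-1)%R%:Z).
  rewrite rmorphD /= -E -pmulrn; set b := nat_of_bool _.
  have : (denom d i)%:R != 0 :> R by rewrite pnatr_eq0 -lt0n denom_gt0.
  by move=> ?; field.
suff [z /step//] : exists z : int,
    diagonal d g j * (denom d j)%:R - 2^-1 = z%:~R.
elim: j => [|j [z /step[{}z Ez]]].
  by exists 1; rewrite /=; field.
set M := (27 * denom d j ^ d.-1)%N.
have oM : odd M by rewrite oddM oddX odd_denom orbT.
have EM : denom d j.+1 = (denom d j * M)%N.
  by rewrite /= /M mulnCA -expnS prednK.
(* For odd [M], [(z + 1/2) * M = z * M + M./2 + 1/2]. *)
exists (z * M%:Z + (M./2)%:Z).
have M2 : M%:R = 1 + 2 * (M./2)%:R :> R.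
  by rewrite -{1}(odd_double_half M) oM natrD -mul2n natrM.
rewrite EM natrM intrD intrM -Ez -!pmulrn M2; by field.
Qed.

(** The intervals are nested: a digit uses at most half of the length [2 / denom d j], and the next
    interval fits into the other half. *)
Lemma diagonal_limit (R : realType) (d : nat) (g : nat -> R) : (0 < d)%N ->
  exists alpha : R, forall j,
    diagonal d g j <= alpha <= diagonal d g j + 2 / (denom d j)%:R.
Proof.
move=> d0.
pose x := diagonal d g; pose y j := x j + 2 / (denom d j)%:R.
have N0 j : 0 < (denom d j)%:R :> R by rewrite ltr0n denom_gt0.
have xS j : x j <= x j.+1.
  by rewrite lerDl divr_ge0 ?ler0n.
have yS j : y j.+1 <= y j.
  rewrite /y /x [diagonal _ _ _.+1]/= -/(x j) -addrA lerD2l.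
  set b := nat_of_bool _.
  have b1 : b%:R / (denom d j)%:R <= 1 / (denom d j)%:R :> R.
    by rewrite ler_pM2r ?invr_gt0 // lern1 /b; case: (_ < _).
  suff : 2 / (denom d j.+1)%:R <= 1 / (denom d j)%:R :> R by lra.
  rewrite ler_pdivrMr // mulrAC ler_pdivlMr // mul1r -natrM ler_nat.
  by apply: leq_trans (denomS_ge j d0); rewrite leq_mul2r orbT.
have xy i j : x i <= y j.
  have [ij|/ltnW ji] := leqP i j.
    apply: (@le_trans _ _ (x j)); last by rewrite lerDl divr_ge0 ?ler0n.
    by move/nondecreasing_seqP: xS; exact.
  apply: (@le_trans _ _ (y i)); first by rewrite lerDl divr_ge0 ?ler0n.
  by move/nonincreasing_seqP: yS; exact.
exists (sup (range x)) => j; apply/andP; split.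
  by apply: ub_le_sup; [exists (y 0%N) => _ [i _ <-] | exists j].
by apply: ge_sup; [exists (x 0%N); exists 0%N | move=> _ [i _ <-]; exact: xy].
Qed.

Lemma odd_approx_set_avoid (R : realType) (d : nat) (g : nat -> R) :
  (0 < d)%N -> exists2 alpha, odd_approx_set d alpha & forall j, alpha <> g j.
Proof.
move=> d0; have [alpha ab] := diagonal_limit g d0.
have N0 j : 0 < (denom d j)%:R :> R by rewrite ltr0n denom_gt0.
exists alpha => j.
  move=> _ /=; have [z Ez] := diagonal_half_int g j d0.
  have /andP[lo hi] := ab j.+1.
  set N : R := (denom d j)%:R; rewrite -/N in Ez.
  have Np : 0 < N by exact: N0.
  have NS : (denom d j.+1)%:R = 27 * N ^+ d :> R by rewrite /= natrM natrX.
  have dz : distZ (alpha * N - 2^-1) <= 2 / (27 * N ^+ d) * N.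
    apply: le_trans (distZ_lb _ z) _; rewrite -Ez.
    have -> : alpha * N - 2^-1 - (diagonal d g j.+1 * N - 2^-1) =
        (alpha - diagonal d g j.+1) * N by ring.
    rewrite ger0_norm; last by rewrite mulr_ge0 ?subr_ge0 ?ler0n.
    by rewrite ler_pM2r // lerBlDl -NS.
  apply: (@le_trans _ _ (N ^+ d * (2 / (27 * N ^+ d) * N))).
    by rewrite ler_wpM2l // exprn_ge0 ?ler0n.
  have -> : N ^+ d * (2 / (27 * N ^+ d) * N) = 2 / 27 * N.
    have : N ^+ d != 0 by rewrite expf_neq0 // gt_eqF.
    by move=> ?; field.
  lra.
have /andP[] := ab j.+1 => /=.
(* With digit 1, [alpha] is at least [diagonal d g j + 1 / denom d j], which exceeds [g j]. With
   digit 0, [g j] is at least that number and the later digits cannot reach it. *)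
case: ltP => gj; rewrite /= ?mul1r ?mul0r => lo hi E; rewrite E in lo hi.
  lra.
have : 2 / (denom d j.+1)%:R < (denom d j)%:R^-1 :> R.
  rewrite ltr_pdivrMr // mulrC ltr_pdivlMr // -natrM ltr_nat.
  by apply: leq_trans (denomS_ge j d0); rewrite ltn_mul2r denom_gt0.
rewrite /= in hi *; lra.
Qed.

Lemma uncountable_odd_approx_set (R : realType) (d : nat) :
  (0 < d)%N -> ~ countable (@odd_approx_set R d).
Proof.
move=> d0 /countable_injP[f finj].
(* [g] inverts the injection [f] on the set, with default 0 off its image, so it enumerates the
   whole set. *)
pose g j := xget 0 [set alpha : R | odd_approx_set d alpha /\ f alpha = j].
have [alpha Ea ng] := odd_approx_set_avoid g d0.
have [Eg fg] : odd_approx_set d (g (f alpha)) /\ f (g (f alpha)) = f alpha.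
  apply: (@xgetPex _ 0 [set a : R | odd_approx_set d a /\ f a = f alpha]).
  by exists alpha.
by apply: (ng (f alpha)); apply: finj; rewrite ?inE.
Qed.

Theorem mainTheorem4 (R : realType) (d : nat) (hd : (3 <= d)%N) :
  exists (E : set R) (eps0 : R),
    [/\ closed E, ~ countable E, 0 < eps0 &
        forall eps : nat -> R,
          (forall n : nat, 0 < eps n) ->
          (forall n : nat, eps n <= eps0) ->
          forall alpha : R, E alpha ->
            ~ basis_of_order2
                [set n : nat | distZ (alpha * n%:R ^+ d) <= eps n]].
Proof.
have d0 : (0 < d)%N by exact: leq_trans hd.
exists (@odd_approx_set R d), 8^-1; split.
- exact: closed_odd_approx_set.
- exact: uncountable_odd_approx_set.
- by rewrite invr_gt0.
- move=> eps _ epsle alpha Ea [M _ bas].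
  (* Beyond the threshold [M] of the basis lies the odd number [denom d M], to which the obstruction
     applies. *)
  have /bas[m mA [n nA mn]] : (M <= denom d M)%N.
    exact: ltnW (ltn_denom M d0).
  apply: (@odd_approx_obstruction R d m n alpha d0); rewrite ?mn ?odd_denom //.
  + exact: Ea.
  + exact: le_trans mA (epsle m).
  + exact: le_trans nA (epsle n).
Qed.
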